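(* For every positive integer $n$, $$p^{(3)}(n)=\sum_{i\ge 1}\hat{p}^{(1)}_i\!\left(n-\binom{i}{2}\right),$$ where $p^{(3)}(n)$ is the number of partitions of $n$ with $3$-distant parts and, for an integer $m$ and $i\ge1$, $\hat{p}^{(1)}_i(m)$ is the number of partitions of $m$ into exactly $i$ distinct parts whose smallest even part is greater than twice the number of odd parts (with $\hat{p}^{(1)}_i(m)=0$ for $m\le 0$). Only the terms with $1\le i\le l(n,3)$ can be nonzero, where $l(n,3)$ is the maximal length of a partition of $n$ with $3$-distant parts.
   Context: A partition of $n$ is a non-increasing sequence of positive integers $\lambda_1\ge\cdots\ge\lambda_l$ summing to $n$; it has $d$-distant parts if $\lambda_j-\lambda_{j+1}\ge d$ for all $j<l$ (so $1$-distant means all parts are distinct). For a partition $\mu$ with distinct parts, $l_o(\mu)$ denotes its number of odd parts and $e(\mu)$ its smallest even part; the condition ''smallest even part greater than twice the number of odd parts'' means $e(\mu)>2l_o(\mu)$, and it is regarded as satisfied when $\mu$ has no even parts. *)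

(* Defs.v *)
From mathcomp Require Import all_boot all_order all_algebra.

Set Implicit Arguments.
Unset Strict Implicit.
Unset Printing Implicit Defensive.

Definition is_partition (n : nat) (s : seq nat) : bool :=
  [&& sorted geq s, all (fun k => 0 < k) s & sumn s == n].

(* Every partition of n has at most n parts, each at most n, so it occurs among
   the bounded sequences filtered here: see mem_partitions. *)
Definition partitions (n : nat) : seq (seq nat) :=
  [seq s <- [seq map val t | t : n.-bseq 'I_n.+1]
  | is_partition n s].

Lemma partitions_uniq n : uniq (partitions n).
Proof.
rewrite filter_uniq // map_inj_uniq ?enum_uniq // => t u.
by move/(inj_map val_inj)/val_inj.
Qed.

Lemma mem_partitions n s : (s \in partitions n) = is_partition n s.
Proof.
rewrite mem_filter; case: (boolP (is_partition n s)) => //= /and3P[_ pos /eqP sn].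
have le_n k : k \in s -> k < n.+1.
  by move=> ks; rewrite ltnS -sn (perm_sumn (perm_to_rem ks)) leq_addr.
have size_n : size s <= n.
  rewrite -sn; elim: s pos {sn le_n} => //= k s IH /andP[k0 /IH].
  by rewrite -add1n; apply: leq_add.
have size_t : size [seq inord k : 'I_n.+1 | k <- s] <= n by rewrite size_map.
apply/mapP; exists (Bseq size_t); first by rewrite mem_enum.
rewrite /= -map_comp -[LHS]map_id; apply/eq_in_map => k ks /=.
by rewrite inordK // le_n.
Qed.

(* The subtraction is truncated; on a partition it is the true difference. *)
Definition distant (d : nat) (s : seq nat) : bool :=
  sorted (fun x y => d <= x - y) s.

Definition num_distant (d n : nat) : nat := count (distant d) (partitions n).

Definition max_length (n d : nat) : nat :=
  \max_(s <- partitions n | distant d s) size s.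

Definition num_odd_parts (s : seq nat) : nat := count odd s.

Definition smallest_even_part (s : seq nat) : option nat :=
  if [seq x <- s | ~~ odd x] is x :: t then Some (foldr minn x t) else None.

Definition even_gt_twice_odd (s : seq nat) : bool :=
  if smallest_even_part s is Some e then 2 * num_odd_parts s < e else true.

Definition phat1 (i : nat) (m : int) : nat :=
  if (0 < m)%R then
    count (fun s => [&& distant 1 s, size s == i & even_gt_twice_odd s])
          (partitions `|m|%N)
  else 0.

(* Main.v *)
Require Import Defs.
From mathcomp Require Import all_boot all_order all_algebra.
From mathcomp Require Import zify.

Set Implicit Arguments.
Unset Strict Implicit.
Unset Printing Implicit Defensive.

(** For each length [i], both sides count the partitions of [n - 3 * 'C(i, 2)]
    into exactly [i] parts.  Adding the staircase [d(i-1), ..., d, 0] to a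
    partition gives a [d]-distant one, at the cost of [d * 'C(i, 2)]; take
    [d = 3] for the left-hand side.  For the right-hand side, put the even
    parts first, each parity class in decreasing order, add the staircase with
    [d = 2], and sort.  This preserves parities, and every even part is raised
    above the steps of the [k] odd parts, so that it exceeds [2k]. *)

Lemma geq_trans : transitive geq.
Proof. by move=> y x z /=; lia. Qed.

Lemma geq_total : total geq.
Proof. by move=> x y /=; lia. Qed.

Lemma geq_anti : antisymmetric geq.
Proof. by move=> x y /=; lia. Qed.

Lemma sort_sortK (T : eqType) (r r' : rel T) (s : seq T) :
  total r -> transitive r -> antisymmetric r ->
  sorted r s -> sort r (sort r' s) = s.
Proof.
move=> r_total r_trans r_anti s_sorted; rewrite -[RHS](sorted_sort r_trans) //.
by apply/perm_sortP => //; apply: permEl (perm_sort r' s).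
Qed.

Lemma sort_geqK (r : rel nat) s : sorted geq s -> sort geq (sort r s) = s.
Proof. exact: sort_sortK geq_total geq_trans geq_anti. Qed.

Lemma eq_count_can (T1 T2 : eqType) (a : pred T1) (b : pred T2) s t
    (f : T1 -> T2) (g : T2 -> T1) :
  uniq s -> uniq t ->
  {in s, forall x, a x -> [/\ f x \in t, b (f x) & g (f x) = x]} ->
  {in t, forall y, b y -> [/\ g y \in s, a (g y) & f (g y) = y]} ->
  count a s = count b t.
Proof.
move=> s_uniq t_uniq fP gP; rewrite -!size_filter -(size_map f).
apply/perm_size/uniq_perm; rewrite ?filter_uniq // ?map_inj_in_uniq.
- exact: filter_uniq.
- move=> x y; rewrite !mem_filter => /andP[ax xs] /andP[ay ys] fxy.
  by have [_ _ <-] := fP x xs ax; have [_ _ <-] := fP y ys ay; rewrite fxy.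
- move=> y; rewrite mem_filter; apply/mapP/andP => [[x] | [b_y yt]].
    by rewrite mem_filter => /andP[ax xs] ->; have [] := fP x xs ax.
  by have [gs ag gK] := gP y yt b_y; exists (g y); rewrite // mem_filter ag.
Qed.

Lemma count_sum_fiber (T : eqType) (a : pred T) (f : T -> nat) s m n :
  {in s, forall x, a x -> m <= f x < n} ->
  count a s = \sum_(m <= i < n) count (fun x => a x && (f x == i)) s.
Proof.
move=> f_bound; under eq_bigr do rewrite -sum1_count big_mkcond /=.
rewrite exchange_big -sum1_count big_mkcond /= [LHS]big_seq [RHS]big_seq.
apply: eq_bigr => x xs; have [ax | nax] := boolP (a x); last by rewrite big1.
rewrite (bigD1_seq (f x)) ?mem_index_iota ?iota_uniq ?f_bound //= eqxx.
by rewrite big1 // => i; rewrite eq_sym => /negbTE->.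
Qed.

Fixpoint map_stair (op : nat -> nat -> nat) (d : nat) (s : seq nat) : seq nat :=
  if s is x :: t then op x (d * size t) :: map_stair op d t else [::].

Local Notation add_stair := (map_stair addn).
Local Notation sub_stair := (map_stair subn).

Section Staircase.

Variable d : nat.
Implicit Type s : seq nat.

Lemma size_map_stair op s : size (map_stair op d s) = size s.
Proof. by elim: s => //= x s ->. Qed.

Lemma add_stairK : cancel (add_stair d) (sub_stair d).
Proof. by elim=> //= x s ->; rewrite size_map_stair addnK. Qed.

Lemma sub_stairK s :
  all (ltn 0) (sub_stair d s) -> add_stair d (sub_stair d s) = s.
Proof.
elim: s => //= x s IH /andP[x_gt /IH ->].
by rewrite size_map_stair subnK // ltnW // -subn_gt0.
Qed.

Lemma sumn_add_stair s :
  sumn (add_stair d s) = sumn s + d * 'C(size s, 2).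
Proof.
elim: s => [|x s IH] /=; first by rewrite muln0.
by rewrite IH binS bin1 mulnDr; lia.
Qed.

Lemma add_stair_ge m s : all (leq m) s -> all (leq m) (add_stair d s).
Proof.
elim: s => //= x s IH /andP[le_mx /IH ->].
by rewrite andbT (leq_trans le_mx) ?leq_addr.
Qed.

Lemma sorted_add_stair (r r' : rel nat) s :
  (forall x y k, r' (x + d * k.+1) (y + d * k) = r x y) ->
  sorted r' (add_stair d s) = sorted r s.
Proof. by move=> r'E; elim: s => [|x [|y s] IH] //=; congr (_ && _). Qed.

End Staircase.

Lemma distant_add_stair d s :
  0 < d -> distant d (add_stair d s) = sorted geq s.
Proof. by move=> d_gt0; apply: sorted_add_stair => x y k /=; lia. Qed.

Lemma distant_sub_stair_gt0 d s :
  0 < d -> distant d s -> all (ltn 0) (sub_stair d s) = all (ltn 0) s.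
Proof.
move=> d_gt0; elim: s => [|x [|y s] IH] //=; first by rewrite muln0 subn0.
by case/andP=> dxy /IH /= <-; lia.
Qed.

Lemma distant_sorted_geq d s : 0 < d -> distant d s -> sorted geq s.
Proof. by move=> d_gt0; apply: sub_sorted => x y /=; lia. Qed.

Lemma distant1E s : distant 1 s = uniq s && sorted geq s.
Proof. by rewrite -gtn_sorted_uniq_geq; apply: eq_sorted => x y; lia. Qed.

Lemma even_gt_twice_oddE s :
  even_gt_twice_odd s = all (fun x => odd x || (2 * count odd s < x)) s.
Proof.
rewrite /even_gt_twice_odd /smallest_even_part /num_odd_parts.
transitivity (all (ltn (2 * count odd s)) (filter (predC odd) s)).
  rewrite -/(predC odd).
  case: (filter _ s) => [|x t] //=; elim: t x => [|y t IH] x /=.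
    by rewrite andbT.
  by rewrite leq_min IH andbCA.
by rewrite all_filter; apply: eq_all => x /=; case: (odd x).
Qed.

Lemma perm_even_gt_twice_odd s t :
  perm_eq s t -> even_gt_twice_odd s = even_gt_twice_odd t.
Proof.
by move=> st; rewrite !even_gt_twice_oddE (perm_all _ st) (permP st).
Qed.

Definition evens_first : rel nat :=
  fun x y => if odd x == odd y then y <= x else odd y.

Lemma evens_first_trans : transitive evens_first.
Proof.
by move=> y x z; rewrite /evens_first; do 3!case: (odd _ =P odd _); lia.
Qed.

Lemma evens_first_total : total evens_first.
Proof.
by move=> x y; rewrite /evens_first; do 2!case: (odd _ =P odd _); lia.
Qed.

Lemma evens_first_anti : antisymmetric evens_first.
Proof.
by move=> x y; rewrite /evens_first; do 2!case: (odd _ =P odd _); lia.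
Qed.

Lemma sort_evens_firstK (r : rel nat) s :
  sorted evens_first s -> sort evens_first (sort r s) = s.
Proof.
exact: sort_sortK evens_first_total evens_first_trans evens_first_anti.
Qed.

Lemma all_odd_evens_first x s :
  odd x -> sorted evens_first (x :: s) -> all odd s.
Proof.
move=> x_odd /(order_path_min evens_first_trans); apply: sub_all => y.
by rewrite /evens_first x_odd; case: (odd y).
Qed.

(* Distinct parts of the same parity differ by at least [2]. *)
Lemma uniq_sorted_add_stair2 s :
  uniq (add_stair 2 s) && sorted evens_first (add_stair 2 s) =
  sorted evens_first s.
Proof.
rewrite sorted_pairwise ?uniq_pairwise -?pairwise_relI; last first.
  exact: evens_first_trans.
rewrite -sorted_pairwise; first apply: sorted_add_stair => x y k /=.
  rewrite /evens_first !mul2n !oddD !odd_double !addbF.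
  by case: (odd x =P odd y); lia.
by move=> y x z /=; rewrite /evens_first; do 3!case: (odd _ =P odd _); lia.
Qed.

Lemma evens_first_head_gt x s :
  x \notin s -> sorted evens_first (x :: s) -> all (ltn 0) (sub_stair 2 s) ->
  (odd x || (2 * count odd s < x)) && (0 < x) = (2 * size s < x).
Proof.
case: s => [|y s]; first by rewrite muln0 /= orbC andbC; case: (0 < x).
rewrite inE negb_or => /andP[neq_xy _] /= /andP[xy ys_sorted] /andP[y_gt _].
have := count_size odd s; move: xy; rewrite /evens_first.
case: eqP => [xy_parity le_yx | xy_parity y_odd] le_count; first by lia.
have := all_odd_evens_first y_odd ys_sorted; rewrite all_count => /eqP s_odd.
by rewrite /= y_odd s_odd; lia.
Qed.

Lemma even_gt_twice_odd_sub_stair2 s : uniq s -> sorted evens_first s ->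
  even_gt_twice_odd s && all (ltn 0) s = all (ltn 0) (sub_stair 2 s).
Proof.
rewrite even_gt_twice_oddE; elim: s => [|x s IH] // /andP[x_notin s_uniq].
move=> xs_sorted; have {}IH := IH s_uniq (path_sorted xs_sorted).
have evens_gtE : all (fun y => odd y || (2 * (odd x + count odd s) < y)) s =
    all (fun y => odd y || (2 * count odd s < y)) s.
  have [x_odd | //] := boolP (odd x).
  have s_odd := all_odd_evens_first x_odd xs_sorted.
  by rewrite !(sub_all _ s_odd) // => y ->.
rewrite /= evens_gtE andbACA IH subn_gt0; apply: andb_id2r => sub_gt0.
rewrite -(evens_first_head_gt x_notin) //.
by case: (odd x).
Qed.

Definition raise_evens_first (s : seq nat) : seq nat :=
  sort geq (add_stair 2 (sort evens_first s)).

Definition lower_evens_first (s : seq nat) : seq nat :=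
  sort geq (sub_stair 2 (sort evens_first s)).

Lemma size_raise_evens_first s : size (raise_evens_first s) = size s.
Proof. by rewrite size_sort size_map_stair size_sort. Qed.

Lemma sumn_raise_evens_first s :
  sumn (raise_evens_first s) = sumn s + 2 * 'C(size s, 2).
Proof.
rewrite (perm_sumn (permEl (perm_sort _ _))) sumn_add_stair size_sort.
by rewrite (perm_sumn (permEl (perm_sort _ _))).
Qed.

Lemma raise_evens_firstP s : sorted geq s -> all (ltn 0) s ->
  [/\ distant 1 (raise_evens_first s),
      even_gt_twice_odd (raise_evens_first s),
      all (ltn 0) (raise_evens_first s)
    & lower_evens_first (raise_evens_first s) = s].
Proof.
move=> s_sorted s_gt0; rewrite /lower_evens_first /raise_evens_first.
set w := sort evens_first s.
have w_sorted : sorted evens_first w by apply: sort_sorted evens_first_total _.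
have /andP[add_uniq add_sorted] :
    uniq (add_stair 2 w) && sorted evens_first (add_stair 2 w).
  by rewrite uniq_sorted_add_stair2.
have /andP[add_even_gt add_gt0] :
    even_gt_twice_odd (add_stair 2 w) && all (ltn 0) (add_stair 2 w).
  by rewrite even_gt_twice_odd_sub_stair2 // add_stairK all_sort.
rewrite all_sort (perm_even_gt_twice_odd (permEl (perm_sort _ _))) distant1E.
rewrite sort_uniq add_uniq (sort_sorted geq_total) sort_evens_firstK //.
by rewrite add_stairK sort_geqK.
Qed.

Lemma lower_evens_firstP s :
  distant 1 s -> even_gt_twice_odd s -> all (ltn 0) s ->
  [/\ sorted geq (lower_evens_first s), all (ltn 0) (lower_evens_first s)
    & raise_evens_first (lower_evens_first s) = s].
Proof.
rewrite distant1E => /andP[s_uniq s_sorted] s_even_gt s_gt0.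
rewrite /lower_evens_first /raise_evens_first; set u := sort evens_first s.
have u_sorted : sorted evens_first u by apply: sort_sorted evens_first_total _.
have sub_gt0 : all (ltn 0) (sub_stair 2 u).
  rewrite -even_gt_twice_odd_sub_stair2 ?sort_uniq // all_sort s_gt0 andbT.
  by rewrite (perm_even_gt_twice_odd (permEl (perm_sort _ _))).
have sub_sorted : sorted evens_first (sub_stair 2 u).
  by rewrite -uniq_sorted_add_stair2 sub_stairK // sort_uniq s_uniq.
rewrite all_sort (sort_sorted geq_total) sort_evens_firstK //.
by rewrite sub_stairK // sort_geqK.
Qed.

Definition num_parts (i n : nat) : nat :=
  count (fun s => size s == i) (partitions n).

Lemma size_partition_eq0 n s : is_partition n s -> (size s == 0) = (n == 0).
Proof. by case: s => [|x s] /and3P[_ /= s_gt0 /eqP <-] //; lia. Qed.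

Lemma num_parts0 i : 0 < i -> num_parts i 0 = 0.
Proof.
move=> i_gt0; apply/eqP; rewrite -leqn0 leqNgt -has_count; apply/hasPn => s.
by rewrite mem_partitions => /size_partition_eq0; case: eqP => //; lia.
Qed.

(* If [n <= k i] then [n - k i = 0], and both sides vanish because [0 < i]. *)
Lemma count_shift_num_parts (a : pred (seq nat)) (k : nat -> nat)
    (f g : seq nat -> seq nat) i n :
  (forall s m, is_partition m s ->
     [/\ is_partition (m + k (size s)) (f s), a (f s),
         size (f s) = size s & g (f s) = s]) ->
  (forall s m, is_partition m s -> a s ->
     is_partition (sumn (g s)) (g s) /\ f (g s) = s) ->
  0 < i ->
  count (fun s => a s && (size s == i)) (partitions n) = num_parts i (n - k i).
Proof.
move=> fP gP i_gt0.
apply: (@eq_count_can _ _ _ _ _ _ g f); rewrite ?partitions_uniq //.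
  move=> s; rewrite !mem_partitions => s_part /andP[a_s /eqP <-].
  have [gs_part gK] := gP _ _ s_part a_s.
  have [gs_shift _ size_f _] := fP _ _ gs_part.
  rewrite gK in gs_shift size_f; rewrite size_f eqxx gK; split=> //.
  move: s_part gs_shift => /and3P[_ _ /eqP <-] /and3P[_ _ /eqP ->].
  by rewrite addnK.
move=> s; rewrite !mem_partitions => s_part /eqP s_size.
have [fs_part -> -> ->] := fP _ _ s_part.
rewrite s_size eqxx in fs_part *; split=> //.
have := size_partition_eq0 s_part; rewrite s_size => i_eq0.
by rewrite subnK // in fs_part; lia.
Qed.

Lemma count_distant d i n : 0 < d -> 0 < i ->
  count (fun s => distant d s && (size s == i)) (partitions n) =
  num_parts i (n - d * 'C(i, 2)).
Proof.
move=> d_gt0.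
apply: (count_shift_num_parts (k := fun i => d * 'C(i, 2))
          (f := add_stair d) (g := sub_stair d)) => s m /and3P[s_sorted s_gt0].
  move=> /eqP <-; have ds : distant d (add_stair d s).
    by rewrite distant_add_stair.
  rewrite size_map_stair add_stairK /is_partition sumn_add_stair eqxx.
  by rewrite add_stair_ge // (distant_sorted_geq d_gt0 ds).
move=> _ ds; have sub_gt0 : all (ltn 0) (sub_stair d s).
  by rewrite distant_sub_stair_gt0.
have subK := sub_stairK sub_gt0; rewrite /is_partition sub_gt0 eqxx subK.
by rewrite -(distant_add_stair _ d_gt0) subK ds.
Qed.

Lemma count_even_gt_twice_odd i n : 0 < i ->
  count (fun s => [&& distant 1 s, size s == i & even_gt_twice_odd s])
        (partitions n) =
  num_parts i (n - 2 * 'C(i, 2)).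
Proof.
under eq_count => s do rewrite (andbC (size s == i)) andbA.
apply: (count_shift_num_parts (k := fun i => 2 * 'C(i, 2))
          (f := raise_evens_first) (g := lower_evens_first))
  => s m /and3P[s_sorted s_gt0].
  move=> /eqP <-.
  have [ds s_even_gt raise_gt0 raiseK] := raise_evens_firstP s_sorted s_gt0.
  rewrite size_raise_evens_first raiseK ds s_even_gt /is_partition.
  by rewrite sumn_raise_evens_first (distant_sorted_geq _ ds) // raise_gt0 eqxx.
move=> _ /andP[ds s_even_gt].
have [lower_sorted lower_gt0 lowerK] := lower_evens_firstP ds s_even_gt s_gt0.
by rewrite /is_partition lower_sorted lower_gt0 eqxx.
Qed.

Lemma phat1_num_parts i m :
  0 < i -> phat1 i m%:Z = num_parts i (m - 2 * 'C(i, 2)).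
Proof.
move=> i_gt0; rewrite /phat1; case: m => [|m]; first by rewrite num_parts0.
exact: count_even_gt_twice_odd.
Qed.

Lemma phat1_subz i m n : phat1 i (m%:Z - n%:Z)%R = phat1 i (m - n)%:Z.
Proof.
have [le_nm | lt_mn] := leqP n m; first by rewrite subzn.
have /eqP-> : m - n == 0 by rewrite subn_eq0 ltnW.
by rewrite /phat1; case: ifP => //; lia.
Qed.

Lemma phat1_distant3 i n : 0 < i ->
  phat1 i (n%:Z - 'C(i, 2)%:Z)%R =
  count (fun s => distant 3 s && (size s == i)) (partitions n).
Proof.
move=> i_gt0; rewrite phat1_subz phat1_num_parts // count_distant //.
by rewrite -subnDA -mulSn.
Qed.

Lemma leq_max_length d n s :
  s \in partitions n -> distant d s -> size s <= max_length n d.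
Proof. exact: leq_bigmax_seq. Qed.

Theorem theorem2 (n : nat) (hn : 0 < n) :
  (forall i : nat, 1 <= i ->
     phat1 i (n%:Z - 'C(i, 2)%:Z)%R <> 0 -> i <= max_length n 3)
  /\
  (forall N : nat, max_length n 3 <= N ->
     num_distant 3 n = \sum_(1 <= i < N.+1) phat1 i (n%:Z - 'C(i, 2)%:Z)%R).
Proof.
split=> [i i_gt0 | N max_le_N].
  rewrite phat1_distant3 // => /eqP; rewrite -lt0n -has_count.
  by case/hasP=> s s_part /andP[ds /eqP <-]; apply: leq_max_length.
under eq_big_nat => i /andP[i_gt0 _] do rewrite phat1_distant3 //.
apply: count_sum_fiber => s s_part ds.
rewrite ltnS (leq_trans (leq_max_length s_part ds)) // andbT lt0n.
by rewrite mem_partitions in s_part; rewrite (size_partition_eq0 s_part) -lt0n.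
Qed.
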